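(* For every integer $k\ge 4$ and every prime power $q$ we have \[ A_q(3k-3,\,2k-2;\,k)\ge q^{4k-6}+q^{k-1}+1 . \]
   Context: For a prime power $q$, $\mathbb{F}_q$ is the finite field with $q$ elements, and $\mathcal{G}_q(n,k)$ is the set of all $k$-dimensional subspaces of $\mathbb{F}_q^n$. The subspace distance of two subspaces $U,W\subseteq\mathbb{F}_q^n$ is $d_S(U,W)=\dim U+\dim W-2\dim(U\cap W)$. $A_q(n,d;k)$ denotes the maximum size of a set $\mathcal{C}\subseteq\mathcal{G}_q(n,k)$ such that $d_S(U,W)\ge d$ for all distinct $U,W\in\mathcal{C}$. *)

(* Defs.v *)
From HB Require Import structures.
From mathcomp Require Import all_boot all_order all_algebra all_field.

Set Implicit Arguments.
Unset Strict Implicit.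
Unset Printing Implicit Defensive.

Import GRing.Theory.

(* {vspace vT} is a subtype of a type of matrices over F, hence finite when F is;
   VectorInternalTheory exposes that encoding. *)
Section FiniteSubspaces.
Import VectorInternalTheory.

HB.instance Definition _ (F : finFieldType) (vT : vectType F) :=
  [Countable of {vspace vT} by <:].
HB.instance Definition _ (F : finFieldType) (vT : vectType F) :=
  [Finite of {vspace vT} by <:].

End FiniteSubspaces.

Definition grassmannian (F : finFieldType) (n k : nat) :
    {set {vspace 'rV[F]_n}} :=
  [set U : {vspace 'rV[F]_n} | \dim U == k].

(* The subtraction in nat never truncates, since \dim (U :&: W) is at most
   \dim U and at most \dim W. *)
Definition subspace_dist (F : finFieldType) (n : nat)
    (U W : {vspace 'rV[F]_n}) : nat :=
  (\dim U + \dim W - 2 * \dim (U :&: W))%N.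

Definition is_constant_dim_code (F : finFieldType) (n d k : nat)
    (C : {set {vspace 'rV[F]_n}}) : bool :=
  (C \subset grassmannian F n k) &&
  [forall U in C, forall W in C, (U != W) ==> (d <= subspace_dist U W)].

(* A_q(n, d; k) for q = #|F|; it depends on F only through q, since finite
   fields of the same order are isomorphic. The empty set is a code, so this is
   a maximum over a nonempty finite family. *)
Definition max_code_size (F : finFieldType) (n d k : nat) : nat :=
  \max_(C : {set {vspace 'rV[F]_n}} | is_constant_dim_code d k C) #|C|.

(* Main.v *)
From HB Require Import structures.
Require Import Defs.
From mathcomp Require Import all_boot all_order all_algebra all_field.
From mathcomp Require Import zify.

Set Implicit Arguments.
Unset Strict Implicit.
Unset Printing Implicit Defensive.

Import GRing.Theory.

(** Two [k]-subspaces are at subspace distance at least [2k - 2] exactly when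
    they meet in dimension at most 1, so the task is to find many [k]-subspaces
    with pairwise intersections of dimension at most 1. Put [n = k - 1] and take
    the ambient space [X * E], where [X = F * L] and [L], [E] are the extensions
    of [F] of degrees [n] and [2n - 1].

    The bulk of the code is a lifted maximum rank distance code: the graphs of
    [x |-> a h(x) + b h(x)^q] for [(a, b)] in [E * E], with [h : X -> E] a linear
    injection and [q = #|F|]. Two such graphs meet along the kernel of the
    difference of the two maps, which is again of this form; such a kernel is at
    most a line because the quotient of two of its nonzero vectors is fixed by
    the Frobenius map, hence lies in [F] ([lker_linearized_dim]). These are
    [q ^ (2 (2n - 1)) = q ^ (4k - 6)] subspaces, all of them meeting [0 * E]
    trivially.

    A [k]-subspace that meets [0 * E] in codimension 1 then meets each of these
    graphs in dimension at most 1. So one may add the products [P_i * A_i], where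
    the [P_i] are distinct lines of [X] and the [A_i] are [n]-subspaces of [E]
    that pairwise meet in dimension at most 1: two products meet in
    [0 * (A_i :&: A_j)]. This is [meets_le_graphs_and_products].

    A family [A_i] of [q ^ n + 1] members is needed (the orthogonal complements
    of such subspaces form a partial spread of [E]). It comes from the same
    principle, with graphs inside [L * H] for [H] of dimension [n - 1]: compose
    the multiplication by [a] in [L] with a surjection [L -> H] with
    one-dimensional kernel. The difference of two such maps is the surjection
    composed with multiplication by a unit, so graphs meet in dimension at most
    1; this gives [q ^ n] subspaces, and a product of a line of [L] with [H] is
    one more. The lines [P_i] of [F * L] arise likewise from the maps [F -> L],
    [c |-> c a], together with one line in [0 * L]. Both families are instances
    of [exists_multiplication_family]. *)

Definition meets_le (F : fieldType) (vT : vectType F) (I : eqType) (t : nat)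
    (f : I -> {vspace vT}) : Prop :=
  forall i j, i != j -> \dim (f i :&: f j) <= t.

(** * Linear maps with prescribed kernel dimension *)

Section LinearMaps.
Variables (F : fieldType).
Local Open Scope ring_scope.

Lemma dim_rV n : \dim {:'rV[F]_n} = n.
Proof. by rewrite dimvf dim_matrix mul1r. Qed.

Lemma dim_prod (X Y : vectType F) :
  \dim {:(X * Y)%type} = (\dim {:X} + \dim {:Y})%N.
Proof. by rewrite !dimvf. Qed.

(** A partial identity matrix of maximal rank. It yields an injection, an
    isomorphism or a surjection according to how the dimensions compare. *)
Lemma exists_lfun_lker_dim (vT wT : vectType F) :
  exists f : 'Hom(vT, wT), \dim (lker f) = (\dim {:vT} - \dim {:wT})%N.
Proof.
pose r := minn (dim vT) (dim wT).
exists (Hom (pid_mx r)); rewrite !dimvf.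
rewrite /dimv genmxE mxrank_ker rank_pid_mx ?geq_minl ?geq_minr //.
by rewrite /r minnE subKn ?leq_subr // subnBA; lia.
Qed.

Lemma exists_lfun_inj (vT wT : vectType F) :
  (\dim {:vT} <= \dim {:wT})%N -> exists h : 'Hom(vT, wT), lker h == 0%VS.
Proof.
move=> le_dim; have [h lker_h] := exists_lfun_lker_dim vT wT.
by exists h; rewrite -dimv_eq0 lker_h subn_eq0.
Qed.

Lemma dim_limg_inj (vT wT : vectType F) (h : 'Hom(vT, wT)) (U : {vspace vT}) :
  lker h == 0%VS -> \dim (h @: U) = \dim U.
Proof. by move=> /eqP h_inj; rewrite limg_dim_eq // h_inj capv0. Qed.

Lemma lker_dim_comp_inj (uT vT wT : vectType F) (h : 'Hom(uT, vT))
    (g : 'Hom(vT, wT)) :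
  lker h == 0%VS -> (\dim (lker (g \o h)) <= \dim (lker g))%N.
Proof.
move=> h_inj; rewrite -(dim_limg_inj (lker _) h_inj).
apply/dimvS/subvP => _ /memv_imgP[x xker ->].
by move: xker; rewrite !memv_ker comp_lfunE.
Qed.

Lemma exists_vspace_dim (vT : vectType F) d :
  (d <= \dim {:vT})%N -> exists U : {vspace vT}, \dim U = d.
Proof.
move=> le_d; have [|h h_inj] := @exists_lfun_inj 'rV[F]_d vT.
  by rewrite dim_rV.
by exists (limg h); rewrite dim_limg_inj // dim_rV.
Qed.

Lemma meets_le_img (vT wT : vectType F) (I : eqType) t (h : 'Hom(vT, wT))
    (f : I -> {vspace vT}) :
  lker h == 0%VS -> meets_le t f -> meets_le t (fun i => h @: f i)%VS.
Proof.
by move=> h_inj tf i j /tf; rewrite -lker0_img_cap // dim_limg_inj.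
Qed.

End LinearMaps.

(** * Graphs and products in a direct product *)

Section Products.
Variables (F : fieldType) (X Y : vectType F).
Local Open Scope ring_scope.
Implicit Types (g h : 'Hom(X, Y)) (U V : {vspace X}) (A B : {vspace Y}).

Definition graph_map g (x : X) : X * Y := (x, g x).

Fact graph_map_linear g : linear (graph_map g).
Proof. by move=> a u v; rewrite /graph_map linearP. Qed.
HB.instance Definition _ g := GRing.isSemilinear.Build F X (X * Y)%type _
  (graph_map g) (GRing.semilinear_linear (graph_map_linear g)).

Definition inr_map (y : Y) : X * Y := (0, y).

Fact inr_map_linear : linear inr_map.
Proof.
by move=> a u v; rewrite /inr_map; congr pair; rewrite /= scaler0 addr0.
Qed.
HB.instance Definition _ := GRing.isSemilinear.Build F Y (X * Y)%type _
  inr_map (GRing.semilinear_linear inr_map_linear).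

Definition graph g : {vspace X * Y} := limg (linfun (graph_map g)).

(** The first summand embeds the left factor as the graph of the zero map. *)
Definition prodv U A : {vspace X * Y} :=
  (linfun (graph_map 0) @: U + linfun inr_map @: A)%VS.

Lemma lker_graph_map g : lker (linfun (graph_map g)) == 0%VS.
Proof. by apply/lker0P => x y; rewrite !lfunE => -[]. Qed.

Lemma lker_inr_map : lker (linfun inr_map) == 0%VS.
Proof. by apply/lker0P => x y; rewrite !lfunE => -[]. Qed.

Lemma mem_graph g (w : X * Y) : (w \in graph g) = (w.2 == g w.1).
Proof.
apply/memv_imgP/eqP => [[x _ ->]|]; first by rewrite lfunE.
by case: w => x y /= ->; exists x; rewrite ?memvf ?lfunE.
Qed.

Lemma mem_prodv U A (w : X * Y) :
  (w \in prodv U A) = (w.1 \in U) && (w.2 \in A).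
Proof.
apply/memv_addP/andP => [[_ /memv_imgP[x xU ->] [_ /memv_imgP[y yA ->] ->]]|].
  by rewrite !lfunE /= zero_lfunE addr0 add0r.
case: w => x y /= [xU yA]; exists (x, 0); last exists (0, y).
- by apply/memv_imgP; exists x; rewrite ?lfunE //= /graph_map zero_lfunE.
- by apply/memv_imgP; exists y; rewrite ?lfunE.
- by congr pair; rewrite /= ?addr0 ?add0r.
Qed.

Lemma dim_graph g : \dim (graph g) = \dim {:X}.
Proof. by rewrite dim_limg_inj ?lker_graph_map. Qed.

Lemma dim_prodv U A : \dim (prodv U A) = (\dim U + \dim A)%N.
Proof.
rewrite dimv_disjoint_sum.
  by rewrite !dim_limg_inj ?lker_graph_map ?lker_inr_map.
apply/eqP; rewrite -subv0; apply/subvP => w; rewrite memv_cap.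
case/andP=> /memv_imgP[x _ ->] /memv_imgP[y _].
rewrite !lfunE /= /graph_map zero_lfunE => -[-> _].
by rewrite memv0.
Qed.

Lemma prodv_cap U V A B :
  (prodv U A :&: prodv V B = prodv (U :&: V) (A :&: B))%VS.
Proof.
by apply/vspaceP=> w; rewrite memv_cap !mem_prodv !memv_cap andbACA.
Qed.

Lemma dim_graph_cap g h : \dim (graph g :&: graph h) = \dim (lker (g - h)).
Proof.
rewrite -(dim_limg_inj (lker _) (lker_graph_map g)).
congr (\dim _); apply/vspaceP => -[x y]; rewrite memv_cap !mem_graph /=.
apply/andP/memv_imgP => [[/eqP-> /eqP eq_gh]|[z /eqlfunP eq_gh]].
  by exists x; [apply/eqlfunP | rewrite lfunE].
by rewrite lfunE => -[-> ->]; rewrite eq_gh.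
Qed.

(** The projection to [X] is injective on a graph and sends the intersection
    into [U]. *)
Lemma dim_graph_cap_prodv g U A : (\dim (graph g :&: prodv U A) <= \dim U)%N.
Proof.
rewrite -(dim_limg_inj U (lker_graph_map g)).
apply/dimvS/subvP => -[x y]; rewrite memv_cap mem_graph mem_prodv /=.
case/and3P => /eqP-> xU _.
by apply/memv_imgP; exists x; rewrite ?lfunE.
Qed.

Definition graphs_and_products (J I : Type) (g : J -> 'Hom(X, Y))
    (U : I -> {vspace X}) (A : I -> {vspace Y}) (s : J + I) :=
  match s with inl j => graph (g j) | inr i => prodv (U i) (A i) end.

(** The linkage principle: a family of graphs extends by products whose left
    factors are small, since a product meets every graph in dimension at most
    that of its left factor. *)
Lemma meets_le_graphs_and_products (J I : eqType) t (g : J -> 'Hom(X, Y))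
    (U : I -> {vspace X}) (A : I -> {vspace Y}) :
  (forall j j', j != j' -> (\dim (lker (g j - g j')%R) <= t)%N) ->
  (forall i, (\dim (U i) <= t)%N) ->
  (forall i i', i != i' ->
     (\dim (U i :&: U i') + \dim (A i :&: A i') <= t)%N) ->
  meets_le t (graphs_and_products g U A).
Proof.
move=> tg tU tUA [j|i] [j'|i'] neq /=.
- by rewrite dim_graph_cap tg.
- exact: leq_trans (dim_graph_cap_prodv _ _ _) (tU i').
- by rewrite capvC; apply: leq_trans (dim_graph_cap_prodv _ _ _) (tU i).
- by rewrite prodv_cap dim_prodv tUA.
Qed.

End Products.

(** * Extensions of a finite field *)

Section FiniteFieldExtensions.
Variable F : finFieldType.
Local Open Scope ring_scope.

Lemma card_finvect (vT : vectType F) :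
  #|finvect_type vT| = (#|F| ^ \dim {:vT})%N.
Proof.
by rewrite -(card_vspacef (Vector.class (finvect_type vT : vectType F)))
  card_vspace.
Qed.

(** The splitting field [L] of [X^(q^n) - X] has exactly [q^n] elements. The
    polynomial is separable, so it has [q^n] distinct roots in [L]; these roots
    are the fixed points of the [n]-th power of the Frobenius automorphism, hence
    form a subfield, which is all of [L] because the roots generate [L]. *)
Lemma exists_finite_extension n : (0 < n)%N ->
  exists L : splittingFieldType F, \dim {:L} = n.
Proof.
move=> n_gt0; set q := #|F|; pose m := (q ^ n)%N.
have q_gt1 : (1 < q)%N := finNzRing_gt1 F.
have m_gt1 : (1 < m)%N by rewrite -(expn0 q) ltn_exp2l.
have m1_gt0 : (0 < m.-1)%N by rewrite -ltnS prednK // ltnW.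
pose Q (R : nzRingType) : {poly R} := 'X^m - 'X.
have DQ R : Q R = ('X^(m.-1) - 1) * ('X - 0).
  by rewrite subr0 mulrBl mul1r -exprSr prednK // ltnW.
have /FinSplittingFieldFor[/= L splitLQ] : Q F != 0.
  by rewrite DQ monic_neq0 ?rpredM ?monicXsubC ?monicXnsubC.
exists L; rewrite rmorphB rmorphXn /= map_polyX -/(Q L) in splitLQ.
have [p p_pr pcharF] := finPcharP F.
have pcharL : p \in [pchar L] by rewrite pchar_lalg.
have qL0 : q%:R = 0 :> L.
  have Dq : q = (p ^ logn p q)%N := card_pprimeChar pcharF.
  rewrite Dq natrX pcharf0 // expr0n; case: eqP => // logq0.
  by rewrite logq0 in Dq; rewrite Dq in q_gt1.
have /finField_galois_generator[/= a _ Da] : (1 <= {:L})%VS by apply: sub1v.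
pose E := fixedSpace (a ^+ n)%g; rewrite dimv1 expn1 in Da.
have [zs DQL defL] := splitLQ.
(* Separability, from Q = (X^(m-1) - 1) X and (m - 1) = -1 in L. *)
have Uzs : uniq zs.
  rewrite -separable_prod_XsubC -(eqp_separable DQL) DQ separable_root andbC.
  rewrite /root !hornerE subr_eq0 eq_sym expr0n gtn_eqF ?oner_eq0 //=.
  rewrite cyclotomic.separable_Xn_sub_1 // -subn1 natrB ?(ltnW m_gt1) //.
  by rewrite natrX qL0 expr0n gtn_eqF // sub0r oppr_eq0 oner_eq0.
have in_zs : zs =i E.
  move=> z; rewrite -root_prod_XsubC -(eqp_root DQL) (sameP fixedSpaceP eqP).
  rewrite /root !hornerE subr_eq0 /= /m; congr (_ == z).
  elim: (n) => [|i IHi]; first by rewrite gal_id.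
  by rewrite expgSr expnSr exprM IHi galM ?Da ?memvf.
have defE : E = {:L}%VS.
  apply/eqP; rewrite eqEsubv subvf -defL -[E]subfield_closed agenvS //.
  by rewrite subv_add sub1v; apply/span_subvP=> z; rewrite in_zs.
apply/eqP; rewrite -(eqn_exp2l _ _ q_gt1) -/m -card_finvect.
have /eq_card-> : finvect_type L =i zs by move=> z; rewrite in_zs defE memvf.
rewrite -eqSS (card_uniqP _) // -(size_prod_XsubC _ id) -(eqp_size DQL).
by rewrite size_polyDl size_polyXn // size_polyN size_polyX.
Qed.

(** The [q]-power map is available as an element of the Galois group, which makes
    it [F]-linear. *)
Lemma exists_frobenius (L : splittingFieldType F) :
  exists2 phi : 'End(L), (forall x, phi x = x ^+ #|F|)
    & forall x, phi x = x -> x \in 1%VS.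
Proof.
have /finField_galois_generator[/= a _ Da] : (1 <= {:L})%VS by apply: sub1v.
rewrite dimv1 expn1 in Da.
exists a => x; first by rewrite Da ?memvf.
by rewrite (Fermat's_little_theorem 1%AS) dimv1 expn1 Da ?memvf // => /eqP.
Qed.

End FiniteFieldExtensions.

(** * Families of subspaces from field multiplication *)

Section Families.
Variable F : finFieldType.
Local Open Scope ring_scope.

(** The maps are [pr \o (a * -) \o h] with [h : X -> L] injective and [pr : L -> Y]
    of minimal kernel. They depend additively on [a], and multiplication by a
    nonzero element is invertible, so the kernel of a difference is no larger
    than that of [pr]. *)
Lemma exists_multiplication_maps (X Y : vectType F) (L : fieldExtType F) :
  (\dim {:X} <= \dim {:L})%N ->
  exists g : finvect_type L -> 'Hom(X, Y),
    forall a b, a != b ->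
      (\dim (lker (g a - g b)%R) <= \dim {:L} - \dim {:Y})%N.
Proof.
move=> leXL; have [h h_inj] := exists_lfun_inj leXL.
have [pr lker_pr] := exists_lfun_lker_dim L Y.
exists (fun a : L => (pr \o (amull a \o h))%VF) => a b neq_ab.
rewrite -lker_pr.
have -> : ((pr \o (amull a \o h)) - (pr \o (amull b \o h)) =
           pr \o (amull (a - b) \o h))%VF.
  apply/lfunP=> x; rewrite add_lfunE opp_lfunE !comp_lfunE !lfunE /=.
  by rewrite mulrBl linearB.
have ab_unit : (a - b : L) \is a GRing.unit by rewrite unitfE subr_eq0.
rewrite comp_lfunA; apply: leq_trans (lker_dim_comp_inj _ h_inj) _.
exact: lker_dim_comp_inj (lker0_amull ab_unit).
Qed.

(** The graphs of the multiplication maps with one more subspace, the product of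
    a [t]-dimensional subspace of [X] with a subspace of [Y] that brings the
    total dimension up to that of [X]. *)
Lemma exists_multiplication_family (X Y : vectType F) (L : fieldExtType F) t :
  (\dim {:X} <= \dim {:L})%N -> (\dim {:L} - \dim {:Y} <= t)%N ->
  (t <= \dim {:X} <= t + \dim {:Y})%N ->
  exists f : finvect_type L + unit -> {vspace X * Y},
    (forall i, \dim (f i) = \dim {:X}) /\ meets_le t f.
Proof.
move=> leXL leLt /andP[letX leXY].
have [g tg] := exists_multiplication_maps Y leXL.
have [U dimU] := exists_vspace_dim letX.
have [|A dimA] := @exists_vspace_dim F Y (\dim {:X} - t); first by lia.
exists (graphs_and_products g (fun=> U) (fun=> A)); split.
  by case=> [a|[]]; rewrite /= ?dim_graph // dim_prodv dimU dimA subnKC.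
apply: meets_le_graphs_and_products => [a b /tg|_|[] []] //.
  by move/leq_trans; apply.
by rewrite dimU.
Qed.

(** Let [v] and [x] be in the kernel of [x |-> a x + b x^q], with [v] nonzero.
    Eliminating [a], respectively [b], between the two equations shows that both
    coefficients annihilate [x^q v - x v^q]; as one of them is nonzero,
    [(x / v)^q = x / v], so [x] is an [F]-multiple of [v]. *)
Lemma lker_linearized_dim (L : fieldExtType F) (phi : 'End(L)) (a b : L) :
  (forall x, phi x = x ^+ #|F|) -> (forall x, phi x = x -> x \in 1%VS) ->
  (a != 0) || (b != 0) ->
  (\dim (lker (amull a + (amull b \o phi)%VF)%R) <= 1)%N.
Proof.
move=> phiE phi_fix ab_neq0; set V := lker _.
pose v := vpick V.
have kerP x : x \in V -> a * x = - (b * phi x).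
  rewrite memv_ker add_lfunE comp_lfunE !lfunE /= addr_eq0; exact: eqP.
have [v0|v_neq0] := eqVneq v 0.
  by move/eqP: v0; rewrite vpick0 => /eqP->; rewrite dimv0.
apply: leq_trans (_ : (\dim <[v]> <= _)%N); last by rewrite dim_vline leq_b1.
apply/dimvS/subvP => x xV.
have vq_neq0 : phi v != 0 by rewrite phiE expf_neq0.
have eq_q : phi x * v = x * phi v.
  have av := kerP _ (memv_pick V); have ax := kerP _ xV.
  rewrite -/v in av.
  have Hb : b * (phi x * v - x * phi v) = 0.
    by apply/eqP; rewrite mulrBr subr_eq0 !mulrA -[b * _ * v]opprK
         -mulNr -ax mulrAC av mulNr opprK mulrAC.
  have Ha : a * (phi x * v - x * phi v) = 0.
    apply/eqP; rewrite mulrBr subr_eq0 [_ * v]mulrC !mulrA av ax !mulNr.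
    by rewrite mulrAC.
  apply/eqP; rewrite -subr_eq0; case/orP: ab_neq0 => nz.
    by move/eqP: Ha; rewrite mulf_eq0 (negPf nz).
  by move/eqP: Hb; rewrite mulf_eq0 (negPf nz).
have /vlineP[c xv] : x / v \in 1%VS.
  apply: phi_fix; rewrite phiE expr_div_n -!phiE.
  by apply/eqP; rewrite eqr_div // eq_q.
by apply/vlineP; exists c; rewrite -[x](divfK v_neq0) xv -scalerAl mul1r.
Qed.

(** The Gabidulin code of [q]-linearized polynomials of [q]-degree at most 1,
    restricted to [X] through an injection into [L]: it is closed under
    differences and its nonzero members have kernels of dimension at most 1. *)
Lemma exists_gabidulin_maps (X : vectType F) (L : splittingFieldType F) :
  (\dim {:X} <= \dim {:L})%N ->
  exists g : finvect_type L * finvect_type L -> 'Hom(X, L),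
    forall s s', s != s' -> (\dim (lker (g s - g s')%R) <= 1)%N.
Proof.
move=> leXL; have [h h_inj] := exists_lfun_inj leXL.
have [phi phiE phi_fix] := exists_frobenius L.
pose lin (a b : L) := (amull a + (amull b \o phi)%VF).
exists (fun s => (lin s.1 s.2 \o h)%VF) => -[a b] [a' b'] neq /=.
have -> : ((lin a b \o h) - (lin a' b' \o h) = lin (a - a') (b - b') \o h)%VF.
  apply/lfunP=> x; rewrite !(add_lfunE, opp_lfunE, comp_lfunE) !lfunE /=.
  by rewrite !mulrBl opprD addrACA.
apply: leq_trans (lker_dim_comp_inj _ h_inj) _.
apply: lker_linearized_dim => //; rewrite !subr_eq0.
by move: neq; rewrite xpair_eqE negb_and.
Qed.

(** * The code *)

(** The ambient space may be any space of the right dimension, since an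
    isomorphism with the row space preserves all dimensions. As [t < k], members
    with different indices are different subspaces, so the index type counts the
    codewords. *)
Lemma card_le_max_code_size n k t (vT : vectType F) (I : finType)
    (f : I -> {vspace vT}) :
  \dim {:vT} = n -> (t < k)%N ->
  (forall i, \dim (f i) = k) -> meets_le t f ->
  (#|I| <= max_code_size F n (2 * k - 2 * t) k)%N.
Proof.
move=> dim_vT lt_tk dim_f tf.
have [|h h_inj] := @exists_lfun_inj F vT 'rV[F]_n.
  by rewrite dim_vT dim_rV.
pose hf i := (h @: f i)%VS.
have dim_hf i : \dim (hf i) = k by rewrite dim_limg_inj.
have thf : meets_le t hf := meets_le_img h_inj tf.
have hf_inj : injective hf.
  move=> i j eq_ij; apply/eqP; apply: contraLR lt_tk => /thf.
  by rewrite -eq_ij capvv dim_hf -leqNgt.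
rewrite -(card_imset _ hf_inj); apply: leq_bigmax_cond.
apply/andP; split.
  by apply/subsetP=> _ /imsetP[i _ ->]; rewrite inE dim_hf.
apply/forall_inP=> _ /imsetP[i _ ->]; apply/forall_inP=> _ /imsetP[j _ ->].
apply/implyP=> neq; have /thf : i != j by apply: contraNneq neq => ->.
by rewrite /subspace_dist !dim_hf; lia.
Qed.

(** The bound with [k = n + 1]. The inequality [2 <= n] is what makes [X], of
    dimension [n + 1], embed into [E], of dimension [2n - 1]. *)
Lemma max_code_size_lower_bound n : (2 <= n)%N ->
  (#|F| ^ (2 * (2 * n - 1)) + #|F| ^ n + 1
     <= max_code_size F (3 * n) (2 * n.+1 - 2 * 1) n.+1)%N.
Proof.
move=> n_ge2.
have [|L dimL] := @exists_finite_extension F n; first exact: ltnW.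
have [|E dimE] := @exists_finite_extension F (2 * n - 1); first by lia.
pose H := 'rV[F]_(n - 1).
have dimH : \dim {:H} = (n - 1)%N by rewrite dim_rV.
have dimF : \dim {:F^o} = 1%N by rewrite dimvf.
(* The lines of X: graphs of maps F -> L, and one line in 0 * L. *)
have [|||P [dimP meetP]] := @exists_multiplication_family F^o L L 0.
- by rewrite dimF dimL ltnW.
- by rewrite subnn.
- by rewrite dimF dimL; lia.
(* The n-subspaces, built in L * H, which has the dimension of E. *)
have [|||A [dimA meetA]] := @exists_multiplication_family L H L 1.
- by [].
- by rewrite dimL dimH; lia.
- by rewrite dimL dimH; lia.
have [|h h_inj] := @exists_lfun_inj F (L * H)%type E.
  by rewrite dim_prod dimE dimL dimH; lia.
have [|g meet_g] := @exists_gabidulin_maps (F^o * L)%type E.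
  by rewrite dim_prod dimF dimL dimE; lia.
pose f := graphs_and_products g P (fun i => h @: A i)%VS.
have dimf i : \dim (f i) = n.+1.
  case: i => [s|i] /=; first by rewrite dim_graph dim_prod dimF dimL.
  by rewrite dim_prodv dimP dim_limg_inj // dimA dimF dimL.
have meet_f : meets_le 1 f.
  apply: meets_le_graphs_and_products => // [i|i j neq_ij].
    by rewrite dimP dimF.
  exact: leq_add (meetP _ _ neq_ij) (meets_le_img h_inj meetA neq_ij).
have dimT : \dim {: ((F^o * L) * E)%type} = (3 * n)%N.
  by rewrite !dim_prod dimF dimL dimE; lia.
have := card_le_max_code_size dimT _ dimf meet_f; rewrite ltnS ltnW //.
rewrite !card_sum card_prod !card_finvect dimL dimE card_unit.
by rewrite -expnD addnn -mul2n -addnA => /(_ isT).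
Qed.

End Families.

Theorem theorem11 (k q p m : nat) (F : finFieldType) :
  4 <= k ->
  prime p -> 0 < m -> q = p ^ m ->
  #|F| = q ->
  q ^ (4 * k - 6) + q ^ (k - 1) + 1
    <= max_code_size F (3 * k - 3) (2 * k - 2) k.
Proof.
move=> k_ge4 _ _ _ <-.
case: k k_ge4 => // n n_ge3; have /max_code_size_lower_bound := ltnW n_ge3.
have -> : 2 * (2 * n - 1) = 4 * n.+1 - 6 by lia.
have -> : 3 * n = 3 * n.+1 - 3 by lia.
by rewrite subn1.
Qed.
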